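(* No smooth cubic threefold $F \subset \mathbb{P}^4$ over $\mathbb{C}$ has an automorphism of order $7$. Up to isomorphism, the Klein cubic threefold $$\{x_1x_5^2+x_5x_3^2+x_3x_4^2+x_4x_2^2+x_2x_1^2=0\}\subset\mathbb{P}^4$$ is the only smooth cubic threefold over $\mathbb{C}$ which has an automorphism of order $11$.
   Context: A smooth cubic threefold is a smooth hypersurface of degree $3$ in the complex projective space $\mathbb{P}^4$. Automorphisms of a smooth cubic threefold $F\subset\mathbb{P}^4$ are induced by elements of $PGL_5(\mathbb{C})$ preserving $F$. *)

(* Defs.v *)
From mathcomp Require Import all_boot all_order all_algebra.
From mathcomp Require Import reals complex mpoly.

Set Implicit Arguments.
Unset Strict Implicit.
Unset Printing Implicit Defensive.

Import GRing.Theory.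
Local Open Scope ring_scope.

(* The complex numbers are C = R[i], over an arbitrary model R of the reals;
   P^4(C) is the set of lines through the origin of C^5. *)
Definition P4 (C : fieldType) : Type :=
  {L : {vspace 'rV[C]_5} | \dim L == 1}.

Definition zero_locus (C : fieldType) (p : {mpoly C[5]}) (x : P4 C) : Prop :=
  forall v, v \in val x -> p.@[v 0] = 0.

(* Smoothness is the Jacobian criterion, tested on homogeneous coordinates. *)
Definition smooth_cubic_threefold (C : fieldType) (p : {mpoly C[5]}) : Prop :=
  [/\ p != 0, p \is 3.-homog &
      forall v : 'rV[C]_5, v != 0 -> p.@[v 0] = 0 ->
        exists i : 'I_5, (p^`M(i)).@[v 0] != 0].

(* A map between subsets of P^4 is represented by a total function
   P4 C -> P4 C, of which only the values on the source matter. *)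

(* f is a morphism from X to Y: it maps X into Y and, around each point a of
   X, there is a basic Zariski-open set {s <> 0} on which f is given by five
   forms h_0, ..., h_4 of the same degree. They have no common zero on X there,
   since the line spanned by their values is the point f x. *)
Definition morphism (C : fieldType) (X Y : P4 C -> Prop) (f : P4 C -> P4 C)
    : Prop :=
  (forall x, X x -> Y (f x)) /\
  forall a, X a ->
    exists (e d : nat) (s : {mpoly C[5]}) (h : 'I_5 -> {mpoly C[5]}),
      [/\ s \is e.-homog,
          forall i, h i \is d.-homog,
          ~ zero_locus s a &
          forall x, X x -> ~ zero_locus s x ->
            forall v, v \in val x -> v != 0 ->
              val (f x) = <[\row_(i < 5) (h i).@[v 0%R]]>%VS].

Definition isomorphism (C : fieldType) (X Y : P4 C -> Prop)
    (f : P4 C -> P4 C) : Prop :=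
  morphism X Y f /\
  exists g, [/\ morphism Y X g,
                forall x, X x -> g (f x) = x &
                forall y, Y y -> f (g y) = y].

Definition isomorphic (C : fieldType) (X Y : P4 C -> Prop) : Prop :=
  exists f, isomorphism X Y f.

(* f coincides on X with the projectivity given by the class of an invertible
   matrix in PGL_5(C); matrices act on row vectors from the right. *)
Definition induced_by_PGL5 (C : fieldType) (X : P4 C -> Prop)
    (f : P4 C -> P4 C) : Prop :=
  exists2 M : 'M[C]_5, M \in unitmx &
    forall x, X x -> val (f x) = (linfun (mulmxr M) @: val x)%VS.

(* Every biregular self-map of a smooth cubic threefold is induced by an
   element of PGL_5(C) preserving it. This classical fact is built into the
   definition; that the projectivity preserves X follows from f being an
   isomorphism of X onto X. *)
Definition automorphism (C : fieldType) (X : P4 C -> Prop)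
    (f : P4 C -> P4 C) : Prop :=
  isomorphism X X f /\ induced_by_PGL5 X f.

Definition has_order (C : fieldType) (X : P4 C -> Prop) (f : P4 C -> P4 C)
    (n : nat) : Prop :=
  [/\ (0 < n)%N,
      forall x, X x -> iter n f x = x &
      forall m, (0 < m < n)%N -> ~ (forall x, X x -> iter m f x = x)].

Definition has_automorphism_of_order (C : fieldType) (X : P4 C -> Prop)
    (n : nat) : Prop :=
  exists f, automorphism X f /\ has_order X f n.

(* The k-th homogeneous coordinate, numbered from 1 to 5. *)
Definition x_ {C : fieldType} (k : nat) : {mpoly C[5]} := 'X_(inord k.-1).

Definition klein_cubic (C : fieldType) : {mpoly C[5]} :=
  x_ 1 * x_ 5 ^+ 2 + x_ 5 * x_ 3 ^+ 2 + x_ 3 * x_ 4 ^+ 2 + x_ 4 * x_ 2 ^+ 2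
  + x_ 2 * x_ 1 ^+ 2.

(* Main.v *)
Require Import Defs.
From mathcomp Require Import all_boot all_order all_algebra.
From mathcomp Require Import reals complex mpoly.
From mathcomp Require Import boolp ring perm cyclic separable cyclotomic.

Set Implicit Arguments.
Unset Strict Implicit.
Unset Printing Implicit Defensive.

Import GRing.Theory Num.Theory.
Local Open Scope ring_scope.

(* Write F(v) = T(v, v, v) with T symmetric trilinear. Through a point of F
   passes a line meeting F in three distinct points (otherwise F is singular),
   so a form of degree at most 3 vanishing on F is a multiple of F. Hence, if a
   matrix M induces an automorphism of prime order q > 3, then F(vM) = c F(v) and
   M ^ q is scalar, so M is diagonal in some basis b, with eigenvalues e_i that
   we normalise to c = 1; then T(b_i, b_j, b_k) <> 0 forces e_i e_j e_k = 1.
   Smoothness at b_i yields some j with T(b_i, b_i, b_j) <> 0, so the set of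
   eigenvalues is stable under e |-> e ^ -2. As the e_i are not all equal, it
   contains a full orbit of multiplication by -2 on (Z/q)^*, up to cube roots of
   unity. For q = 7 that orbit has six elements, too many for a basis of C^5. For
   q = 11 it has exactly five, the only monomials of weight 0 are those of the
   Klein cubic, and their coefficients are scaled to 1 by extracting a 33rd
   root. *)

(** * Functions that are polynomial along lines *)

Lemma poly_eq0_of_horner (C : numDomainType) (p : {poly C}) :
  (forall x, p.[x] = 0) -> p = 0.
Proof.
move=> p0; apply/eqP; apply: contraT => pN0.
have := max_poly_roots (rs := [seq i%:R | i <- iota 0 (size p)]) pN0.
rewrite size_map size_iota ltnn; apply.
  by apply/allP => x _; apply/rootP.
by rewrite map_inj_uniq ?iota_uniq //; apply: mulrIn; exact: oner_neq0.
Qed.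

Section PolynomialOnLines.
Variables (C : numDomainType) (V : lmodType C).
Implicit Types (f g : V -> C) (u v w : V).

(** Polynomiality is asked on each line separately, with no bound on the degree: this is stable
    under the ring operations and enough to cancel a factor of a product. *)
Definition poly_on_lines f :=
  forall v w, exists p : {poly C}, forall t, f (v + t *: w) = p.[t].

Lemma poly_on_lines_cst c : poly_on_lines (fun=> c).
Proof. by move=> v w; exists c%:P => t; rewrite hornerC. Qed.

Lemma poly_on_linesD f g :
  poly_on_lines f -> poly_on_lines g -> poly_on_lines (fun v => f v + g v).
Proof.
move=> fP gP v w; have [p pE] := fP v w; have [q qE] := gP v w.
by exists (p + q) => t; rewrite hornerD pE qE.
Qed.

Lemma poly_on_linesM f g :
  poly_on_lines f -> poly_on_lines g -> poly_on_lines (fun v => f v * g v).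
Proof.
move=> fP gP v w; have [p pE] := fP v w; have [q qE] := gP v w.
by exists (p * q) => t; rewrite hornerM pE qE.
Qed.

Lemma poly_on_linesB f g :
  poly_on_lines f -> poly_on_lines g -> poly_on_lines (fun v => f v - g v).
Proof.
move=> fP gP v w; have [p pE] := fP v w; have [q qE] := gP v w.
by exists (p - q) => t; rewrite hornerD hornerN pE qE.
Qed.

Lemma poly_on_linesX f n :
  poly_on_lines f -> poly_on_lines (fun v => f v ^+ n).
Proof.
move=> fP v w; have [p pE] := fP v w.
by exists (p ^+ n) => t; rewrite horner_exp pE.
Qed.

Lemma poly_on_lines_linear f :
  (forall v w t, f (v + t *: w) = f v + t * f w) -> poly_on_lines f.
Proof.
move=> fE v w; exists ((f v)%:P + (f w)%:P * 'X) => t.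
by rewrite fE !hornerE mulrC.
Qed.

(** On the line joining [v] to [v0] both functions become polynomials in one variable with zero
    product, and the second one is not zero, since [t = 1] gives [v0]. *)
Lemma poly_on_lines_eq0 f g v0 : poly_on_lines f -> poly_on_lines g ->
  (forall v, f v * g v = 0) -> g v0 != 0 -> forall v, f v = 0.
Proof.
move=> fP gP fg0 gN0 v.
have [p pE] := fP v (v0 - v); have [q qE] := gP v (v0 - v).
have /eqP : p * q = 0.
  by apply: poly_eq0_of_horner => t; rewrite hornerM -pE -qE.
rewrite mulf_eq0 => /orP[/eqP p0|/eqP q0].
  by rewrite -[v]addr0 -(scale0r (v0 - v)) pE p0 horner0.
by move: gN0; rewrite -[v0](subrKC v) -[v0 - v]scale1r qE q0 horner0 eqxx.
Qed.

End PolynomialOnLines.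

(** * Discriminant and distinct roots of a cubic polynomial in one variable *)

Definition cubic_discr (C : pzRingType) (a b c d : C) : C :=
  b ^+ 2 * c ^+ 2 - 4%:R * a * c ^+ 3 - 4%:R * b ^+ 3 * d
  - 27%:R * a ^+ 2 * d ^+ 2 + 18%:R * a * b * c * d.

(** Once the coefficients are expressed through the roots by Vieta's formulas, the discriminant is
    [a ^+ 4] times the square of the product of the differences of the roots. *)
Lemma cubic_distinct_roots (C : numClosedFieldType) (a b c d : C) :
  a != 0 -> cubic_discr a b c d != 0 ->
  exists r1 r2 r3, [/\ r1 != r2, r1 != r3, r2 != r3 &
    forall r, r \in [:: r1; r2; r3] ->
      a * r ^+ 3 + b * r ^+ 2 + c * r + d = 0].
Proof.
move=> aN0 discN0.
pose p := Poly [:: d; c; b; a].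
have pE : p = [:: d; c; b; a] :> seq C by rewrite (@PolyK _ 0).
have [rs rsE] := closed_field_poly_normal p.
have lcE : lead_coef p = a by rewrite lead_coefE pE.
have : size rs = 3.
  have : size p = 4 by rewrite pE.
  by rewrite rsE size_scale ?lead_coef_eq0 -?lead_coef_eq0 ?lcE // size_prod_XsubC => -[].
case: rs rsE => [|r1 [|r2 [|r3 [|//]]]] // rsE _.
have rE r : a * r ^+ 3 + b * r ^+ 2 + c * r + d =
            a * ((r - r1) * ((r - r2) * (r - r3))).
  transitivity p.[r]; first by rewrite horner_Poly /=; ring.
  by rewrite rsE lcE !big_cons big_nil !hornerE /= mulr1.
have [bE cE dE] : [/\ b = - a * (r1 + r2 + r3),
    c = a * (r1 * r2 + r1 * r3 + r2 * r3) & d = - a * (r1 * r2 * r3)].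
  pose q := Poly [:: - a * (r1 * r2 * r3);
                     a * (r1 * r2 + r1 * r3 + r2 * r3); - a * (r1 + r2 + r3); a].
  have pq : p = q.
    apply/eqP; rewrite -subr_eq0; apply/eqP; apply: poly_eq0_of_horner => r.
    rewrite hornerD hornerN !horner_Poly /=; apply/eqP; rewrite subr_eq0.
    by apply/eqP; transitivity (a * r ^+ 3 + b * r ^+ 2 + c * r + d); [ring|rewrite rE; ring].
  have qE : q = [:: - a * (r1 * r2 * r3);
                     a * (r1 * r2 + r1 * r3 + r2 * r3); - a * (r1 + r2 + r3); a] :> seq C.
    by rewrite (@PolyK _ 0).
  have : [:: d; c; b; a] = q :> seq C by rewrite -pE pq.
  by rewrite qE => -[-> -> ->].
have discE : cubic_discr a b c d =
    a ^+ 4 * ((r1 - r2) * (r1 - r3) * (r2 - r3)) ^+ 2.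
  by rewrite /cubic_discr bE cE dE; ring.
move: discN0; rewrite discE mulf_eq0 expf_eq0 (negPf aN0) expf_eq0 /= !mulf_eq0 !subr_eq0 !negb_or.
move=> /andP[/andP[r12 r13] r23].
exists r1, r2, r3; split=> // r; rewrite !inE rE => /or3P[] /eqP->; ring.
Qed.

Lemma Poly_eq0_of_horner (C : numDomainType) (cs : seq C) :
  (forall x, (Poly cs).[x] = 0) -> forall i, cs`_i = 0.
Proof. by move=> /poly_eq0_of_horner cs0 i; rewrite -coef_Poly cs0 coef0. Qed.

(** * Symmetric trilinear forms *)

Record symtrilinear (C : pzRingType) (V : lmodType C) := SymTrilinear {
  trilinear_fun :> V -> V -> V -> C;
  trilinearC12 : forall u v w, trilinear_fun u v w = trilinear_fun v u w;
  trilinearC23 : forall u v w, trilinear_fun u v w = trilinear_fun u w v;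
  trilinearP : forall a u u' v w, trilinear_fun (a *: u + u') v w =
    a * trilinear_fun u v w + trilinear_fun u' v w }.

Section SymTrilinear.
Variables (C : comPzRingType) (V : lmodType C) (T : symtrilinear V).
Implicit Types u v w x y : V.

Lemma trilinearC13 u v w : T u v w = T w v u.
Proof. by rewrite trilinearC12 trilinearC23 trilinearC12. Qed.

Lemma trilinearD1 u u' v w : T (u + u') v w = T u v w + T u' v w.
Proof. by rewrite -[u]scale1r trilinearP mul1r scale1r. Qed.

Lemma trilinear01 v w : T 0 v w = 0.
Proof. by apply: (addrI (T 0 v w)); rewrite -trilinearD1 !addr0. Qed.

Lemma trilinearZ1 a u v w : T (a *: u) v w = a * T u v w.
Proof. by rewrite -[a *: u]addr0 trilinearP trilinear01 addr0. Qed.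

Lemma trilinearD2 u v v' w : T u (v + v') w = T u v w + T u v' w.
Proof. by rewrite trilinearC12 trilinearD1 !(trilinearC12 _ u). Qed.

Lemma trilinearZ2 a u v w : T u (a *: v) w = a * T u v w.
Proof. by rewrite trilinearC12 trilinearZ1 (trilinearC12 _ u). Qed.

Lemma trilinearD3 u v w w' : T u v (w + w') = T u v w + T u v w'.
Proof. by rewrite trilinearC13 trilinearD1 !(trilinearC13 u). Qed.

Lemma trilinearZ3 a u v w : T u v (a *: w) = a * T u v w.
Proof. by rewrite trilinearC13 trilinearZ1 (trilinearC13 u). Qed.

Definition trilinearE := (trilinearD1, trilinearD2, trilinearD3,
  trilinearZ1, trilinearZ2, trilinearZ3).

Lemma trilinear_sum3 I (r : seq I) (P : pred I) (f : I -> V) u v :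
  T u v (\sum_(i <- r | P i) f i) = \sum_(i <- r | P i) T u v (f i).
Proof.
apply: (big_morph (T u v)) => [w w'|]; first exact: trilinearD3.
by rewrite trilinearC13 trilinear01.
Qed.

Lemma trilinear_line v w t :
  T (v + t *: w) (v + t *: w) (v + t *: w) =
  T v v v + 3%:R * t * T v v w + 3%:R * t ^+ 2 * T v w w + t ^+ 3 * T w w w.
Proof.
rewrite !trilinearE !(trilinearC12 T w v) (trilinearC23 T v w v).
by rewrite (trilinearC13 w w v); ring.
Qed.

End SymTrilinear.

(** [3 T v v u] is the derivative of [v |-> T v v v] in the direction [u]. Where the cubic does not
    vanish, [u = v] satisfies the condition, so quantifying over all non-zero [v] still expresses
    the Jacobian criterion. *)
Definition smooth_trilinear (C : fieldType) (V : lmodType C)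
    (T : symtrilinear V) : Prop :=
  forall v, v != 0 -> exists u, T v v u != 0.

(** The two forms are the columns of a matrix of rank at most 2, whose left kernel is non-zero in
    dimension at least 3. *)
Lemma common_kernel (C : fieldType) n (f g : 'rV[C]_n.+3 -> C) :
  (forall a u v, f (a *: u + v) = a * f u + f v) ->
  (forall a u v, g (a *: u + v) = a * g u + g v) ->
  exists2 w, w != 0 & f w = 0 /\ g w = 0.
Proof.
move=> f_lin g_lin.
pose A : 'M[C]_(n.+3, 2) := \matrix_(i, j)
  (if j == 0 then f else g) (delta_mx 0 i).
have : kermx A != 0.
  rewrite -mxrank_eq0 mxrank_ker subn_eq0 -ltnNge.
  exact: leq_ltn_trans (rank_leq_col _) _.
case/rowV0Pn => w /sub_kermxP wA0 wN0; exists w => //.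
have key (h : 'rV[C]_n.+3 -> C) j :
    (forall a u v, h (a *: u + v) = a * h u + h v) ->
    (forall i, A i j = h (delta_mx 0 i)) -> h w = 0.
  move=> h_lin AE; transitivity ((w *m A) 0 j); last by rewrite wA0 mxE.
  have h0 : h 0 = 0.
    by have := h_lin 1 0 0; rewrite scaler0 addr0 mul1r => /esym/eqP; rewrite -subr_eq0 addrK => /eqP.
  rewrite {1}(row_sum_delta w) mxE.
  rewrite (big_morph h (id1 := 0) (op1 := +%R)) //.
    apply: eq_bigr => i _; rewrite AE.
    by rewrite -[_ *: _]addr0 h_lin h0 addr0.
  by move=> u v; rewrite -[u in LHS]scale1r h_lin mul1r.
by split; [apply: (key f 0)|apply: (key g 1)] => // i; rewrite mxE.
Qed.

(** * A line meeting a smooth cubic in three distinct points *)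

Section TransversalLine.
Variables (C : numClosedFieldType) (n : nat).
Notation V := 'rV[C]_n.+3.
Variable T : symtrilinear V.

Lemma trilinear_zero : exists2 a, a != 0 & T a a a = 0.
Proof.
pose e : V := delta_mx 0 0; pose e' : V := delta_mx 0 1.
have delta_neq0 (i : 'I_n.+3) : delta_mx 0 i != 0 :> V.
  apply/eqP => /rowP/(_ i); rewrite !mxE !eqxx /= => /eqP.
  by rewrite oner_eq0.
have [e0|eN0] := eqVneq (T e e e) 0; first by exists e; rewrite ?delta_neq0.
(* As [e] is off the cubic, the restriction to the line [e' + t e] has degree exactly 3 in [t],
   hence a root. *)
pose p := Poly [:: T e' e' e'; 3%:R * T e' e' e; 3%:R * T e' e e; T e e e].
have p_size : size p = 4 by rewrite /p (@PolyK _ 0).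
have [|t /rootP pt0] := closed_rootP p _; first by rewrite p_size.
exists (e' + t *: e); last first.
  by rewrite -pt0 trilinear_line horner_Poly /=; ring.
apply/eqP => /rowP/(_ 1); rewrite !mxE /= mulr0 addr0 => /eqP.
by rewrite oner_eq0.
Qed.

(** The discriminant of the cubic restricted to the line [v + t w], as a polynomial in [t]. *)
Definition line_discr w v :=
  cubic_discr (T w w w) (3%:R * T v w w) (3%:R * T v v w) (T v v v).

Lemma trilinear_poly_on_lines w : [/\ poly_on_lines (fun v => T v w w),
  poly_on_lines (fun v => T v v w) & poly_on_lines (fun v => T v v v)].
Proof.
split=> v x.
- by exists (Poly [:: T v w w; T x w w]) => t; rewrite horner_Poly /= !trilinearE; ring.
- exists (Poly [:: T v v w; 2%:R * T v x w; T x x w]) => t.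
  by rewrite horner_Poly /= !trilinearE (trilinearC12 T x v); ring.
exists (Poly [:: T v v v; 3%:R * T v v x; 3%:R * T v x x; T x x x]) => t.
by rewrite horner_Poly /= trilinear_line; ring.
Qed.

Lemma line_discr_poly_on_lines w : poly_on_lines (line_discr w).
Proof.
have [T1 T2 T3] := trilinear_poly_on_lines w.
rewrite /line_discr /cubic_discr.
by repeat first [assumption | apply: poly_on_lines_cst
  | apply: poly_on_linesB | apply: poly_on_linesD
  | apply: poly_on_linesM | apply: poly_on_linesX].
Qed.

Hypothesis T_smooth : smooth_trilinear T.

(* When [T a a a = 0], the discriminant of [t |-> F(a + t w) / t] is, up to a
   factor 3, the difference of the two sides. *)
Lemma tangent_quadric_not_cone a : a != 0 ->
  ~ forall w, 3%:R * T a w w ^+ 2 = 4%:R * T a a w * T w w w.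
Proof.
move=> aN0 QLF; have [u uN0] := T_smooth aN0.
have Q0 x : T a a x = 0 -> T a x x = 0.
  move=> ax0; have /eqP := QLF x.
  by rewrite ax0 mulr0 mul0r mulf_eq0 pnatr_eq0 /= expf_eq0 /= => /eqP.
(* The hypothesis at [x + s u] is an identity of polynomials in [s]. As [T a x x = 0], its left side
   is divisible by [s ^ 2], so the coefficient [4 l T x x x] of [s] on the right is zero. *)
have F0 x : T a a x = 0 -> T x x x = 0.
  move=> ax0; pose m := T a x u; pose q := T a u u; pose l := T a a u.
  have /Poly_eq0_of_horner/(_ 1) : forall s, (Poly [:: 0; 4%:R * l * T x x x;
      4%:R * l * (3%:R * T x x u) - 12%:R * m ^+ 2;
      4%:R * l * (3%:R * T x u u) - 12%:R * m * q;
      4%:R * l * T u u u - 3%:R * q ^+ 2]).[s] = 0.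
    move=> s; have := QLF (x + s *: u).
    rewrite trilinear_line !trilinearE ax0 (Q0 x) // (trilinearC23 T a u x).
    rewrite -/m -/q -/l => /eqP; rewrite -subr_eq0 => /eqP E.
    by rewrite horner_Poly /=; apply: oppr_inj; rewrite oppr0 -[RHS]E; ring.
  move=> /= /eqP; rewrite !mulf_eq0 pnatr_eq0 /= (negPf uN0) /=.
  by move/eqP.
(* For this [w] the linear form [T w w] is zero: on the hyperplane [T a a x = 0] because the cubic
   vanishes there, and at [u] by the coefficient of [s ^ 2], where the term in [T a w u] is gone. So
   the cubic is singular at [w]. *)
have [w wN0 [aw0 mw0]] : exists2 w, w != 0 & T a a w = 0 /\ T a w u = 0.
  by apply: common_kernel => b x y; rewrite !trilinearE.
have Tww x : T a a x = 0 -> T w w x = 0.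
  move=> ax0; have /Poly_eq0_of_horner/(_ 1) : forall s, (Poly [:: T w w w;
      3%:R * T w w x; 3%:R * T w x x; T x x x]).[s] = 0.
    move=> s; rewrite -[RHS](F0 (w + s *: x)).
      by rewrite trilinear_line horner_Poly /=; ring.
    by rewrite !trilinearE aw0 ax0; ring.
  by move=> /= /eqP; rewrite mulf_eq0 pnatr_eq0 /= => /eqP.
have wwu : T w w u = 0.
  pose q := T a u u; pose l := T a a u.
  have /Poly_eq0_of_horner/(_ 2) : forall s, (Poly [:: 0; 4%:R * l * T w w w;
      4%:R * l * (3%:R * T w w u);
      4%:R * l * (3%:R * T w u u);
      4%:R * l * T u u u - 3%:R * q ^+ 2]).[s] = 0.
    move=> s; have := QLF (w + s *: u).
    rewrite trilinear_line !trilinearE aw0 (Q0 w) // (trilinearC23 T a u w) mw0.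
    rewrite -/q -/l => /eqP; rewrite -subr_eq0 => /eqP E.
    by rewrite horner_Poly /=; apply: oppr_inj; rewrite oppr0 -[RHS]E; ring.
  by move=> /= /eqP; rewrite !mulf_eq0 !pnatr_eq0 /= (negPf uN0) /= => /eqP.
have [y] := T_smooth wN0; apply/negP; rewrite negbK.
pose c := T a a y / T a a u.
have -> : y = (y - c *: u) + c *: u by rewrite subrK.
rewrite trilinearD3 trilinearZ3 wwu mulr0 addr0; apply/eqP/Tww.
rewrite -scaleNr !trilinearE /c; field.
exact: uN0.
Qed.

(** Fix a zero [a] of the cubic and vary the direction [w]. If all the discriminants were zero, the
    product of [D], the square of the linear form [T a a] and the cubic would vanish identically;
    cancelling leaves [D = 0], which [tangent_quadric_not_cone] forbids. *)
Lemma transversal_line : exists w v, T w w w != 0 /\ line_discr w v != 0.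
Proof.
have [a aN0 a0] := trilinear_zero.
have [w [wN0 waN0]] : exists w, T w w w != 0 /\ line_discr w a != 0;
  last by exists w, a.
apply: contrapT => noline; apply: (tangent_quadric_not_cone aN0).
have [_ _ F_poly] := trilinear_poly_on_lines 0.
have L_poly : poly_on_lines (fun w => T a a w).
  by apply: poly_on_lines_linear => v w t; rewrite !trilinearE.
have Q_poly : poly_on_lines (fun w => T a w w).
  move=> v x; exists (Poly [:: T a v v; 2%:R * T a v x; T a x x]) => t.
  by rewrite horner_Poly /= !trilinearE (trilinearC23 T a x v); ring.
have [u uN0] := T_smooth aN0.
pose D w := 3%:R * T a w w ^+ 2 - 4%:R * T a a w * T w w w.
have D_poly : poly_on_lines D.
  apply: poly_on_linesB; repeat first [assumption | apply: poly_on_lines_cst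
    | apply: poly_on_linesM | apply: poly_on_linesX].
suff [f fN0] : exists f, T f f f != 0.
  have FLD w : (D w * T a a w ^+ 2) * T w w w = 0.
    have [->|wN0] := eqVneq (T w w w) 0; first by rewrite mulr0.
    have [d0|dN0] := eqVneq (line_discr w a) 0; last by case: noline; exists w.
    suff -> : D w * T a a w ^+ 2 = 0 by rewrite mul0r.
    have : 27%:R * (D w * T a a w ^+ 2) = 0.
      by rewrite -d0 /line_discr /cubic_discr a0 /D; ring.
    by move/eqP; rewrite mulf_eq0 pnatr_eq0 /= => /eqP.
  have LD : forall w, D w * T a a w ^+ 2 = 0.
    apply: (poly_on_lines_eq0 (v0 := f)) FLD fN0 => //.
    by apply: poly_on_linesM => //; exact: poly_on_linesX.
  have Dw : forall w, D w = 0.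
    apply: (poly_on_lines_eq0 (v0 := u)) LD _ => //; first exact: poly_on_linesX.
    by rewrite expf_eq0.
  by move=> w; apply/eqP; rewrite -subr_eq0; apply/eqP/Dw.
(* If the cubic were zero everywhere, the coefficient of [s] in its value at [a + s u] would give
   [T a a u = 0]. *)
apply: contrapT => noF.
have F0 x : T x x x = 0.
  by apply/eqP; apply: contraT => xN0; case: noF; exists x.
have /Poly_eq0_of_horner/(_ 1)/eqP : forall s, (Poly [:: T a a a;
    3%:R * T a a u; 3%:R * T a u u; T u u u]).[s] = 0.
  by move=> s; rewrite -(F0 (a + s *: u)) trilinear_line horner_Poly /=; ring.
by rewrite /= mulf_eq0 pnatr_eq0 /= (negPf uN0).
Qed.

(* [G] need only be quadratic along lines of direction [w]: cubic forms are
   brought to this shape by subtracting a multiple of [T]. *)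
Lemma eq0_of_vanishing_on_zeros w v0 (G : V -> C) :
  T w w w != 0 -> line_discr w v0 != 0 -> poly_on_lines G ->
  (forall v, exists b c, forall t, G (v + t *: w) = G v + b * t + c * t ^+ 2) ->
  (forall v, T v v v = 0 -> G v = 0) -> forall v, G v = 0.
Proof.
move=> wN0 dN0 G_poly G_quad GX.
(* It suffices that [G] times the discriminant vanishes. Where the discriminant is non-zero, the
   line meets the cubic in three points, too many zeros for [G], which is quadratic along it. *)
apply: (poly_on_lines_eq0 G_poly (line_discr_poly_on_lines w)) dN0 => v.
have [->|vN0] := eqVneq (line_discr w v) 0; first by rewrite mulr0.
have [r1 [r2 [r3 [r12 r13 r23 rP]]]] := cubic_distinct_roots wN0 vN0.
have [b [c GE]] := G_quad v.
pose p := Poly [:: G v; b; c].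
have pr r : r \in [:: r1; r2; r3] -> root p r.
  move=> /rP r0; apply/rootP; rewrite horner_Poly /=.
  by rewrite -[RHS](GX (v + r *: w)) ?GE ?trilinear_line -?[RHS]r0; ring.
have p0 : p = 0.
  apply/eqP; apply: contraT => pN0.
  have := max_poly_roots (rs := [:: r1; r2; r3]) pN0.
  rewrite /= !inE negb_or r12 r13 r23 /= andbT => /(_ _ isT).
  rewrite ltnNge (size_Poly [:: G v; b; c]); apply.
  by rewrite /= !pr ?inE ?eqxx ?orbT.
have GvE : G v = p`_0 by rewrite /p coef_Poly.
by rewrite GvE p0 coef0 mul0r.
Qed.

End TransversalLine.

(** * Operations on trilinear forms and polarization of cubic forms *)

Section TrilinearOperations.
Variables (C : comPzRingType) (V W : lmodType C).

Program Definition trilinear_add (S T : symtrilinear V) : symtrilinear V :=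
  @SymTrilinear _ _ (fun u v w => S u v w + T u v w) _ _ _.
Next Obligation. by rewrite trilinearC12 (trilinearC12 T). Qed.
Next Obligation. by rewrite trilinearC23 (trilinearC23 T). Qed.
Next Obligation. by rewrite !trilinearP; ring. Qed.

Program Definition trilinear_scale c (T : symtrilinear V) : symtrilinear V :=
  @SymTrilinear _ _ (fun u v w => c * T u v w) _ _ _.
Next Obligation. by rewrite trilinearC12. Qed.
Next Obligation. by rewrite trilinearC23. Qed.
Next Obligation. by rewrite trilinearP; ring. Qed.

Program Definition trilinear_comp (f : {linear W -> V}) (T : symtrilinear V) :
  symtrilinear W :=
  @SymTrilinear _ _ (fun u v w => T (f u) (f v) (f w)) _ _ _.
Next Obligation. by rewrite trilinearC12. Qed.
Next Obligation. by rewrite trilinearC23. Qed.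
Next Obligation. by rewrite linearP trilinearP. Qed.

End TrilinearOperations.

Section Polarization.
Variables (C : numFieldType).

(** Comparing the coefficients of [t] at [u + t v] settles the case of a repeated argument;
    expanding at [u + v] in the repeated argument then gives the general case. *)
Lemma trilinear_eq_diag (V : lmodType C) (S T : symtrilinear V) :
  (forall v, S v v v = T v v v) -> forall u v w, S u v w = T u v w.
Proof.
move=> diag.
have diag2 u v : S u u v = T u u v.
  have /Poly_eq0_of_horner/(_ 1) : forall t, (Poly [:: S u u u - T u u u;
      3%:R * (S u u v - T u u v); 3%:R * (S u v v - T u v v);
      S v v v - T v v v]).[t] = 0.
    move=> t; have /eqP := diag (u + t *: v); rewrite !trilinear_line -subr_eq0.
    by move=> /eqP E; rewrite horner_Poly /= -[RHS]E; ring.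
  by move=> /eqP; rewrite /= mulf_eq0 pnatr_eq0 /= subr_eq0 => /eqP.
move=> u v w; have := diag2 (u + v) w.
rewrite !trilinearE !diag2 (trilinearC12 S v) (trilinearC12 T v) => /eqP.
rewrite -subr_eq0 => /eqP E; apply/eqP; rewrite -subr_eq0.
have : 2%:R * (S u v w - T u v w) = 0 by rewrite -[RHS]E; ring.
by move=> /eqP; rewrite mulf_eq0 pnatr_eq0.
Qed.

(** The symmetrisation of [X_i X_j X_k]; dividing by 6 makes its diagonal that monomial, whichever
    indices coincide. *)
Program Definition trilinear_monomial n (i j k : 'I_n) :
    symtrilinear 'rV[C]_n :=
  @SymTrilinear _ _ (fun u v w => 6%:R^-1 *
    (u 0 i * v 0 j * w 0 k + u 0 i * v 0 k * w 0 j + u 0 j * v 0 i * w 0 k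
     + u 0 j * v 0 k * w 0 i + u 0 k * v 0 i * w 0 j + u 0 k * v 0 j * w 0 i))
    _ _ _.
Next Obligation. by ring. Qed.
Next Obligation. by ring. Qed.
Next Obligation. by rewrite !mxE; ring. Qed.

Lemma mdegS_split n (m : 'X_{1..n}) d : mdeg m = d.+1 ->
  exists i m', m = (U_(i) + m')%MM /\ mdeg m' = d.
Proof.
move=> md; have [i mi] : exists i, m i != 0.
  apply/existsP; rewrite -negb_forall; apply/negP => /forallP m0.
  have m00 : m = 0%MM by apply/mnmP => i; rewrite mnm0E; exact/eqP.
  by rewrite m00 mdeg0 in md.
have mE : m = (U_(i) + (m - U_(i)))%MM.
  by rewrite addmC submK // lep1mP.
exists i, (m - U_(i))%MM; split=> //.
by move: md; rewrite {1}mE mdegD mdeg1 => -[].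
Qed.

(** By linearity it suffices to treat products of three variables. The clause on derivatives
    translates the Jacobian criterion into [smooth_trilinear]. *)
Lemma polarization n (p : {mpoly C[n]}) : p \is 3.-homog ->
  exists T : symtrilinear 'rV[C]_n, forall v : 'rV[C]_n,
    p.@[v 0] = T v v v /\
    forall i, (p^`M(i)).@[v 0] = 3%:R * T v v (delta_mx 0 i).
Proof.
move/dhomogP => p_homog; rewrite (mpolyE p) big_seq.
elim/big_ind: _ => [|q r [S SP] [T TP]|m /p_homog /mdegS_split[i [m1 [-> ]]]].
- have [T0 T00] : exists T : symtrilinear 'rV[C]_n, forall u v w, T u v w = 0.
    by exists (@SymTrilinear _ _ (fun _ _ _ => 0) (fun _ _ _ => erefl)
      (fun _ _ _ => erefl) (fun a _ _ _ _ => esym (eq_trans (addr0 _) (mulr0 a)))).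
  exists T0 => v; rewrite meval0 T00; split=> // i.
  by rewrite mderiv0 meval0 T00 mulr0.
- exists (trilinear_add S T) => v; have [Sv Sd] := SP v; have [Tv Td] := TP v.
  rewrite mevalD Sv Tv; split=> // i.
  by rewrite mderivD mevalD Sd Td mulrDr.
case/mdegS_split=> j [m2 [-> /eqP/mdeg1P[k /eqP->]]].
set c := p@__; exists (trilinear_scale c (trilinear_monomial i j k)) => v.
rewrite !mpolyXD mevalZ !mevalM !mevalXU /=; split; first by field.
move=> l; rewrite mderivZ mevalZ !mderivM !(mevalD, mevalM) !mderivX !mnm1E.
have dE (x : 'I_n) : ((x == l)%:R *: 'X_[U_(x) - U_(l)]).@[v 0] =
    (delta_mx 0 l : 'rV[C]_n) 0 x.
  rewrite mxE eqxx mevalZ /= eq_sym; case: eqP => [->|]; last by rewrite mul0r.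
  by rewrite (_ : _ - _ = 0)%MM ?mpolyX0 ?meval1 ?mulr1 //; apply/mnmP => y; rewrite mnmBE mnm0E subnn.
by rewrite !dE !mevalXU; field.
Qed.

End Polarization.

(** * What the zero set of a smooth cubic determines *)

Section ZeroSetDeterminesForm.
Variables (C : numClosedFieldType) (n : nat).
Notation V := 'rV[C]_n.+3.
Variable T : symtrilinear V.
Hypothesis T_smooth : smooth_trilinear T.

(** Subtracting [c * T], with [c] the ratio of the values at [w], kills the coefficient of [t ^ 3]
    along [w], so that [eq0_of_vanishing_on_zeros] applies. *)
Lemma proportional_of_zeros (S : symtrilinear V) :
  (forall v, T v v v = 0 -> S v v v = 0) ->
  exists c, forall u v w, S u v w = c * T u v w.
Proof.
move=> SX; have [w [v0 [wN0 dN0]]] := transversal_line T_smooth.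
pose c := S w w w / T w w w; exists c.
suff SE v : S v v v - c * T v v v = 0.
  apply: (@trilinear_eq_diag _ _ S (trilinear_scale c T)) => v /=.
  by apply/eqP; rewrite -subr_eq0 SE.
move: v; apply: (eq0_of_vanishing_on_zeros wN0 dN0).
- have [_ _ S_poly] := trilinear_poly_on_lines S 0.
  have [_ _ T_poly] := trilinear_poly_on_lines T 0.
  by apply: poly_on_linesB => //; apply: poly_on_linesM => //; exact: poly_on_lines_cst.
- move=> v; exists (3%:R * (S v v w - c * T v v w)),
    (3%:R * (S v w w - c * T v w w)) => t.
  by rewrite !trilinear_line /c; field.
by move=> v Tv0; rewrite SX // Tv0 mulr0 subrr.
Qed.

(** The 2 by 2 minors of the pair [v *m A], [v] are quadratic forms vanishing on the cubic, hence
    zero; so every vector is an eigenvector of [A]. *)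
Lemma scalar_of_zeros_eigen (A : 'M[C]_n.+3) :
  (forall v, T v v v = 0 -> exists a, v *m A = a *: v) -> exists a, A = a%:M.
Proof.
move=> eig; have [w [v0 [wN0 dN0]]] := transversal_line T_smooth.
have minor (v : V) i j : (v *m A) 0 i * v 0 j - (v *m A) 0 j * v 0 i = 0.
  pose G (v : V) := (v *m A) 0 i * v 0 j - (v *m A) 0 j * v 0 i.
  move: v; apply: (eq0_of_vanishing_on_zeros (G := G) wN0 dN0).
  - apply: poly_on_linesB; apply: poly_on_linesM; apply: poly_on_lines_linear => v x t;
      by rewrite ?mulmxDl -?scalemxAl !mxE.
  - move=> v; exists ((v *m A) 0 i * w 0 j + (w *m A) 0 i * v 0 j
      - (v *m A) 0 j * w 0 i - (w *m A) 0 j * v 0 i),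
      ((w *m A) 0 i * w 0 j - (w *m A) 0 j * w 0 i) => t.
    by rewrite /G mulmxDl -scalemxAl !mxE; ring.
  by move=> v /eig[a vA]; rewrite /G vA !mxE; ring.
have A_diag k i : i != k -> A k i = 0.
  move=> ik; have := minor (delta_mx 0 k) i k.
  by rewrite -rowE !mxE !eqxx (negPf ik) /= mulr1 mulr0 subr0.
exists (A 0 0); apply/matrixP => k l; rewrite !mxE.
have [<-|kl] := eqVneq k l; last by rewrite A_diag // eq_sym.
have [->//|k0] := eqVneq k 0.
(* Being an eigenvector, the sum of two basis vectors forces their eigenvalues to agree. *)
have := minor (delta_mx 0 k + delta_mx 0 0) k 0.
rewrite mulmxDl -!rowE !mxE !eqxx (negPf k0) (eq_sym 0 k) (negPf k0) /=.
rewrite (A_diag 0 k) // (A_diag k 0) 1?eq_sym //.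
by rewrite !add0r !addr0 !mulr1 => /eqP; rewrite subr_eq0 mulr1n => /eqP.
Qed.

End ZeroSetDeterminesForm.

(** * Roots of unity and diagonalization *)

Section RootsOfUnity.
Variable C : numClosedFieldType.

Lemma Xn_sub_1_split q : (0 < q)%N ->
  exists2 rs : seq C, uniq rs & 'X^q - 1 = \prod_(x <- rs) ('X - x%:P).
Proof.
move=> q_gt0; have [rs] := closed_field_poly_normal ('X^q - 1 : {poly C}).
rewrite (monicP _) ?monicXnsubC // scale1r => rsE; exists rs => //.
by rewrite -separable_prod_XsubC -rsE separable_Xn_sub_1 // pnatr_eq0 -lt0n.
Qed.

Lemma primitive_root_exists q : (0 < q)%N ->
  exists z : C, q.-primitive_root z.
Proof.
move=> q_gt0; have [rs rs_uniq rsE] := Xn_sub_1_split q_gt0.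
have rs1 : all q.-unity_root rs.
  by apply/allP => z; rewrite -root_prod_XsubC -rsE.
have rs_size : (q <= size rs)%N.
  by rewrite -ltnS -(size_prod_XsubC rs id) -rsE size_XnsubC.
by have /hasP[z _] := has_prim_root q_gt0 rs1 rs_uniq rs_size; exists z.
Qed.

(** After division by a [q]-th root of [a], the matrix is annihilated by [X ^ q - 1], which has
    simple roots. The eigenvectors are rows, as matrices act on the right. *)
Lemma diagonalizable_root_of_scalar n (A : 'M[C]_n.+1) q a : (0 < q)%N ->
  a != 0 -> A ^+ q = a%:M ->
  exists2 P : 'M[C]_n.+1, P \in unitmx &
    exists d : 'I_n.+1 -> C, forall i, row i P *m A = d i *: row i P.
Proof.
move=> q_gt0 aN0 Aq; pose b := q.-root a.
have bq : b ^+ q = a by rewrite rootCK.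
have bN0 : b != 0 by apply: contraNneq aN0 => b0; rewrite -bq b0 expr0n gtn_eqF.
have /diagonalizableP[P Punit] : exists2 rs, uniq rs &
    mxminpoly (b^-1 *: A) %| \prod_(x <- rs) ('X - x%:P).
  have [rs rs_uniq rsE] := Xn_sub_1_split q_gt0; exists rs => //.
  rewrite -rsE; apply: mxminpoly_min.
  rewrite rmorphB rmorphXn rmorph1 /= horner_mx_X exprZn Aq exprVn bq.
  by rewrite scale_scalar_mx mulVf // subrr.
move=> /diagonalizable_forPex[D /(simmxP Punit) PA]; exists P => //.
exists (fun i => b * D 0 i) => i.
have : P *m A = b *: (diag_mx D *m P).
  by rewrite -PA -scalemxAr scalerA divff // scale1r.
by move=> /(congr1 (row i)); rewrite row_mul linearZ /= row_mul row_diag_mx -scalemxAl -rowE scalerA.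
Qed.

End RootsOfUnity.

(** * Points of projective space and projectivities *)

Section ProjectivePoints.
Variable C : fieldType.
Notation V := 'rV[C]_5.

Lemma vline_P4 (v : V) : v != 0 -> \dim <[v]>%VS == 1%N.
Proof. by move=> vN0; rewrite dim_vline vN0. Qed.

Definition point (v : V) (vN0 : v != 0) : P4 C := exist _ <[v]>%VS (vline_P4 vN0).

Lemma P4_vline (x : P4 C) v : v \in val x -> v != 0 -> val x = <[v]>%VS.
Proof.
move=> vx vN0; apply/esym/eqP; rewrite eqEdim -memvE vx dim_vline vN0 /=.
by have := valP x; rewrite /= => /eqP->.
Qed.

Lemma P4_vlineP (x : P4 C) : exists2 v : V, v != 0 & val x = <[v]>%VS.
Proof.
have xN0 : val x != 0%VS by rewrite -dimv_eq0 (eqP (valP x)).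
by exists (vpick (val x)); rewrite ?vpick0 //; apply: P4_vline;
  rewrite ?memv_pick ?vpick0.
Qed.

Lemma P4_eqP (x y : P4 C) : val x = val y -> x = y.
Proof. exact: val_inj. Qed.

Lemma vline_eq (u v : V) : v \in <[u]>%VS -> v != 0 -> <[u]>%VS = <[v]>%VS.
Proof.
move=> vu vN0; apply/esym/eqP; rewrite eqEdim -memvE vu !dim_vline vN0.
by case: eqP.
Qed.

Lemma linfun_mulmxr_vline (M : 'M[C]_5) (v : V) :
  (linfun (mulmxr M) @: <[v]>)%VS = <[v *m M]>%VS.
Proof. by rewrite limg_line lfunE. Qed.

Lemma mulmx_unit_eq0 (M : 'M[C]_5) (v : V) : M \in unitmx ->
  (v *m M == 0) = (v == 0).
Proof.
move=> Mu; apply/eqP/eqP => [vM0|->]; last by rewrite mul0mx.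
by rewrite -(mulmxK Mu v) vM0 mul0mx.
Qed.

Lemma projectivity_subproof (M : 'M[C]_5) (x : P4 C) : M \in unitmx ->
  \dim (linfun (mulmxr M) @: val x)%VS == 1%N.
Proof.
move=> Mu; have [v vN0 ->] := P4_vlineP x.
by rewrite linfun_mulmxr_vline dim_vline mulmx_unit_eq0 // vN0.
Qed.

Definition projectivity (M : 'M[C]_5) (Mu : M \in unitmx) (x : P4 C) : P4 C :=
  exist (fun L : {vspace V} => is_true (\dim L == 1)) _
    (projectivity_subproof x Mu).

Lemma projectivityK (M N : 'M[C]_5) (Mu : M \in unitmx) (Nu : N \in unitmx) :
  M *m N = 1%:M -> cancel (projectivity Mu) (projectivity Nu).
Proof.
move=> MN x; apply: P4_eqP; have [v vN0 xE] := P4_vlineP x.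
by rewrite /= xE !linfun_mulmxr_vline -mulmxA MN mulmx1.
Qed.

Lemma iter_projective (X : P4 C -> Prop) (f : P4 C -> P4 C) (M : 'M[C]_5) :
  (forall x, X x -> X (f x)) ->
  (forall x, X x -> val (f x) = (linfun (mulmxr M) @: val x)%VS) ->
  forall m x v, X x -> val x = <[v]>%VS ->
    X (iter m f x) /\ val (iter m f x) = <[v *m M ^+ m]>%VS.
Proof.
move=> fX fM m x v Xx xv; elim: m => [|m [Xm IH]].
  by rewrite expr0 mulmx1.
split; first exact: fX.
by rewrite iterS fM // IH linfun_mulmxr_vline -mulmxA exprSr.
Qed.

Definition row_forms (M : 'M[C]_5) (i : 'I_5) : {mpoly C[5]} :=
  \sum_j M j i *: 'X_j.

Lemma row_forms_homog M i : row_forms M i \is 1.-homog.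
Proof.
rewrite /row_forms; apply: rpred_sum => j _.
by apply: rpredZ; rewrite dhomogX; apply/eqP; exact: mdeg1.
Qed.

Lemma row_formsE M (v : V) : \row_i (row_forms M i).@[v 0] = v *m M.
Proof.
apply/rowP => i; rewrite !mxE /row_forms raddf_sum /=; apply: eq_bigr => j _.
by rewrite mevalZ mevalXU mulrC.
Qed.

Lemma projectivity_morphism (X Y : P4 C -> Prop) (M : 'M[C]_5)
    (Mu : M \in unitmx) :
  (forall x, X x -> Y (projectivity Mu x)) -> morphism X Y (projectivity Mu).
Proof.
move=> XY; split=> // a _.
(* The same linear forms serve at every point: the open set is that of the constant [1], a form of
   degree 0. *)
exists 0%N, 1%N, 1, (row_forms M); split.
- exact: dhomog1.
- by move=> i; exact: row_forms_homog.
- have [v vN0 aE] := P4_vlineP a.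
  move=> /(_ v); rewrite aE memv_line meval1 => /(_ isT)/eqP.
  by rewrite oner_eq0.
move=> x _ _ v vx vN0; rewrite row_formsE /= (P4_vline vx vN0).
exact: linfun_mulmxr_vline.
Qed.

Lemma projectivity_isomorphism (X Y : P4 C -> Prop) (M : 'M[C]_5)
    (Mu : M \in unitmx) (M'u : invmx M \in unitmx) :
  (forall x, X x -> Y (projectivity Mu x)) ->
  (forall y, Y y -> X (projectivity M'u y)) ->
  isomorphism X Y (projectivity Mu).
Proof.
move=> XY YX; split; first exact: projectivity_morphism.
exists (projectivity M'u); split; first exact: projectivity_morphism.
- by move=> x _; apply: projectivityK; rewrite mulmxV.
by move=> y _; apply: projectivityK; rewrite mulVmx.
Qed.

Lemma zero_locus_projectivity (p q : {mpoly C[5]}) (M : 'M[C]_5)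
    (Mu : M \in unitmx) :
  (forall v : V, p.@[v 0] = 0 -> q.@[(v *m M) 0] = 0) ->
  forall x, zero_locus p x -> zero_locus q (projectivity Mu x).
Proof.
move=> pq x px v; have [u uN0 xE] := P4_vlineP x.
rewrite /= xE linfun_mulmxr_vline => /vlineP[a ->].
by rewrite scalemxAl; apply: pq; apply: px; rewrite xE memvZ // memv_line.
Qed.

Lemma zero_locus_isomorphism (p q : {mpoly C[5]}) (M : 'M[C]_5)
    (Mu : M \in unitmx) :
  (forall v : V, q.@[(v *m M) 0] = p.@[v 0]) ->
  isomorphism (zero_locus p) (zero_locus q) (projectivity Mu).
Proof.
move=> pq; have M'u : invmx M \in unitmx by rewrite unitmx_inv.
apply: (projectivity_isomorphism (M'u := M'u)); apply: zero_locus_projectivity => v.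
  by rewrite pq.
by rewrite -pq mulmxKV.
Qed.

End ProjectivePoints.

(** * Weights attached to an automorphism of finite order *)

Lemma sum_row_unitmx (C : fieldType) n (P : 'M[C]_n) (u : 'rV[C]_n) :
  P \in unitmx -> u = \sum_k (u *m invmx P) 0 k *: row k P.
Proof. by move=> Pu; rewrite -mulmx_sum_row mulmxKV. Qed.

Lemma row_unitmx_neq0 (C : fieldType) n (P : 'M[C]_n) i :
  P \in unitmx -> row i P != 0.
Proof.
move=> Pu; apply/eqP => Pi0; have : row i (P *m invmx P) = 0.
  by rewrite row_mul Pi0 mul0mx.
by rewrite mulmxV // => /rowP/(_ i)/eqP; rewrite !mxE eqxx oner_eq0.
Qed.

Section Weights.
Variables (C : numClosedFieldType).
Notation V := 'rV[C]_5.

Lemma smooth_polarization (F : {mpoly C[5]}) : smooth_cubic_threefold F ->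
  exists2 T : symtrilinear V, smooth_trilinear T & forall v : V, F.@[v 0] = T v v v.
Proof.
case=> _ /polarization[T TP] F_smooth; exists T => [v vN0|v]; last by case: (TP v).
have [Tv Td] := TP v.
have [v0|vvN0] := eqVneq (T v v v) 0; last by exists v.
have [|i] := F_smooth v vN0; first by rewrite Tv.
by rewrite Td mulf_eq0 negb_or => /andP[_ iN0]; exists (delta_mx 0 i).
Qed.

(** A non-zero linear form is non-zero on some vector of a basis. In the coordinates given by [P], a
    monomial [x_i ^ 2 x_j] occurs in the cubic for every [i]. *)
Lemma smooth_row_neighbour (T : symtrilinear V) (P : 'M[C]_5) (i : 'I_5) :
  smooth_trilinear T -> P \in unitmx ->
  exists j, T (row i P) (row i P) (row j P) != 0.
Proof.
move=> T_smooth Pu; have [u] := T_smooth _ (row_unitmx_neq0 i Pu).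
rewrite (sum_row_unitmx u Pu) trilinear_sum3 => sN0.
apply/existsP; apply: contraNT sN0 => /existsPn T0.
by rewrite big1 // => j _; rewrite trilinearZ3 (eqP (negPn (T0 j))) mulr0.
Qed.

(** The weight [e i] is the eigenvalue [d i] of the matrix divided by a cube root of the factor [c]
    by which the matrix multiplies the cubic. *)
Lemma weights (F : {mpoly C[5]}) (T : symtrilinear V) q : (1 < q)%N ->
  smooth_trilinear T -> (forall v : V, F.@[v 0] = T v v v) ->
  has_automorphism_of_order (zero_locus F) q ->
  exists (P : 'M[C]_5) (e : 'I_5 -> C) (nu : C),
  [/\ P \in unitmx,
      forall i j k, T (row i P) (row j P) (row k P) != 0 -> e i * e j * e k = 1,
      forall i, e i ^+ q = nu &
      ~ forall i j, e i = e j].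
Proof.
move=> q_gt1 T_smooth FE [f [[[[fX _] _] [M Mu fM]] [q_gt0 fq f_ord]]].
have pointX (v : V) (vN0 : v != 0) : T v v v = 0 -> zero_locus F (point vN0).
  by move=> v0 w /= /vlineP[a ->]; rewrite FE !trilinearE v0 !mulr0.
have TX (v : V) : T v v v = 0 -> T (v *m M) (v *m M) (v *m M) = 0.
  have [->|vN0] := eqVneq v 0; first by rewrite mul0mx.
  move=> /(pointX v vN0) vX; have := fX _ vX (v *m M).
  by rewrite FE; apply; rewrite fM // linfun_mulmxr_vline memv_line.
have [c TM] := proportional_of_zeros T_smooth (S := trilinear_comp (mulmxr M) T) TX.
have cN0 : c != 0.
  have [w [v0 [wN0 _]]] := transversal_line T_smooth.
  apply: contraNneq wN0 => c0; have := TM (w *m invmx M) (w *m invmx M) (w *m invmx M).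
  by rewrite /= !mulmxKV // c0 mul0r => ->.
(* The [q]-th iterate of [f] fixes every point of the cubic, so each zero is an eigenvector of
   [M ^ q]. *)
have [a Mq] : exists a, M ^+ q = a%:M.
  apply: (scalar_of_zeros_eigen T_smooth) => v v0.
  have [->|vN0] := eqVneq v 0; first by exists 0; rewrite mul0mx scaler0.
  have vX := pointX v vN0 v0.
  have [_] := iter_projective fX fM q vX (erefl : val (point vN0) = <[v]>%VS).
  by rewrite fq // => vE; apply/vlineP; rewrite (vE : <[v]>%VS = _) memv_line.
have aN0 : a != 0.
  apply: contraTneq (unitrX q Mu) => a0; rewrite Mq a0.
  by rewrite raddf0 unitr0.
have [P Pu [d dE]] := diagonalizable_root_of_scalar q_gt0 aN0 Mq.
have rowMX i m : row i P *m M ^+ m = d i ^+ m *: row i P.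
  elim: m => [|m IH]; first by rewrite !expr0 mulmx1 scale1r.
  by rewrite exprSr mulmxA IH -scalemxAl dE scalerA -exprSr.
have dq i : d i ^+ q = a.
  apply/eqP; rewrite -subr_eq0; have /eqP := rowMX i q.
  rewrite Mq mul_mx_scalar eq_sym -subr_eq0 -scalerBl scaler_eq0.
  by rewrite (negPf (row_unitmx_neq0 i Pu)) orbF.
pose z := 3.-root c; have z3 : z ^+ 3 = c by rewrite rootCK.
have zN0 : z != 0 by apply: contraNneq cN0 => z0; rewrite -z3 z0 expr0n.
exists P, (fun i => d i / z), (a / z ^+ q); split=> //.
- move=> i j k ijkN0; have dc : d i * d j * d k = c.
    apply: (mulIf ijkN0); rewrite -TM /= !dE !trilinearE; ring.
  have -> : d i / z * (d j / z) * (d k / z) = d i * d j * d k / z ^+ 3 by field.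
  by rewrite z3 dc divff.
- by move=> i; rewrite expr_div_n dq.
(* Equal weights would make [M] scalar and [f] the identity on the cubic, of order 1 instead of
   [q > 1]. *)
move=> e_const; have d_const i : d i = d 0.
  by apply: (mulIf (invr_neq0 zN0)); exact: e_const.
apply: (f_ord 1%N) => [|x xX]; first by rewrite q_gt1.
apply: P4_eqP; have [v vN0 xE] := P4_vlineP x.
rewrite -[iter _ f x]/(f x) fM // xE linfun_mulmxr_vline.
have -> : v *m M = d 0 *: v.
  rewrite {1}(sum_row_unitmx v Pu) mulmx_suml [in RHS](sum_row_unitmx v Pu) scaler_sumr.
  by apply: eq_bigr => i _; rewrite -scalemxAl dE d_const scalerA mulrC -scalerA.
have dN0 : d 0 != 0.
  by apply: contraNneq aN0 => d0; rewrite -(dq 0) d0 expr0n gtn_eqF.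
by apply/esym; apply: vline_eq; rewrite ?memvZ ?memv_line // scaler_eq0 negb_or dN0.
Qed.

End Weights.

(** * Weights of prime order, and the exclusion of order 7 *)

Section CyclicWeights.
Variables (C : numClosedFieldType) (q : nat) (e : 'I_5 -> C) (nu : C).
Variable s : 'I_5 -> 'I_5.
Hypotheses (q_prime : prime q) (q_gt3 : (3 < q)%N).
Hypothesis es : forall i, e i ^+ 2 * e (s i) = 1.
Hypothesis eq_nu : forall i, e i ^+ q = nu.

(** Raising [e i ^ 2 * e (s i) = 1] to the power [q] gives [nu ^ 3 = 1]. *)
Lemma weight_exp3q i : e i ^+ (3 * q) = 1.
Proof.
rewrite mulnC exprM eq_nu exprSr -{1}(eq_nu i) -(eq_nu (s i)) -exprM mulnC exprM.
by rewrite -exprMn es expr1n.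
Qed.

(** On weights, [s] acts as [e |-> e ^ -2]; the natural number [3 q - 2] represents [-2] modulo
    [3 q]. *)
Lemma weight_iter i k : e (iter k s i) = e i ^+ ((3 * q - 2) ^ k).
Proof.
have eN0 j : e j != 0.
  by apply/eqP => e0; have /eqP := es j; rewrite e0 expr0n mul0r eq_sym oner_eq0.
elim: k => [|k IH]; first by rewrite expr1.
rewrite iterS expnSr exprM -IH; set j := iter k s i.
apply: (mulfI (expf_neq0 2 (eN0 j))); rewrite es -exprD subnKC ?weight_exp3q //.
by rewrite (@leq_trans (3 * 1)) // leq_mul2l /= (ltn_trans _ q_gt3).
Qed.

(** Since [q ^ 2 = 1] modulo 3, weights that are all cube roots of unity are determined by [nu]:
    each [e i] equals [e i ^ (q * q) = nu ^ q]. *)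
Lemma weight_cube_neq1 : ~ (forall i j, e i = e j) -> exists i, e i ^+ 3 != 1.
Proof.
move=> e_nonconst; apply/existsP; apply: contra_notT e_nonconst => /existsPn e3.
have {}e3 i : e i ^+ 3 = 1 by apply/eqP/negPn/e3.
suff eE i : e i = nu ^+ (q %% 3) by move=> i j; rewrite !eE.
rewrite -(eq_nu i) -exprM -(expr_mod _ (e3 i)).
suff -> : (q * (q %% 3) %% 3 = 1)%N by rewrite expr1.
rewrite -modnMml.
have : coprime 3 q by rewrite prime_coprime // dvdn_prime2 // ltn_eqF.
by rewrite prime_coprime // /dvdn; case: (q %% 3)%N (ltn_pmod q (isT : 0 < 3)%N) => [|[|[|]]].
Qed.

(** The order of [e i] divides [3 q] but not 3, so [q] divides it. *)
Lemma weight_expr_eq i m n : e i ^+ 3 != 1 -> e i ^+ m = e i ^+ n -> m = n %[mod q].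
Proof.
move=> e3 /eqP; have q3_gt0 : (0 < 3 * q)%N by rewrite muln_gt0 (prime_gt0 q_prime).
have [o o_prim o_dvd] := prim_order_exists q3_gt0 (weight_exp3q i).
rewrite (eq_prim_root_expr o_prim) => mn.
have q_dvd : (q %| o)%N.
  apply: contraNT e3; rewrite -prime_coprime // coprime_sym => oq.
  by rewrite -(prim_order_dvd o_prim) -(Gauss_dvdl _ oq).
wlog le_nm : m n mn / (n <= m)%N.
  move=> wl; have /orP[|le_mn] := leq_total n m; first exact: wl.
  by apply/esym; apply: wl; rewrite // eq_sym.
apply/eqP; move: mn; rewrite !eqn_mod_dvd //; exact: dvdn_trans.
Qed.

End CyclicWeights.

Lemma no_order7 (C : numClosedFieldType) (F : {mpoly C[5]}) :
  smooth_cubic_threefold F -> ~ has_automorphism_of_order (zero_locus F) 7.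
Proof.
move=> /smooth_polarization[T T_smooth FE].
move=> /(weights (isT : 1 < 7)%N T_smooth FE)[P [e [nu [Pu eT e7 e_nonconst]]]].
have /fin_all_exists[s sT] i : exists j, T (row i P) (row i P) (row j P) != 0.
  exact: smooth_row_neighbour.
have es i : e i ^+ 2 * e (s i) = 1 by rewrite expr2; exact: eT.
have [i ei3] := weight_cube_neq1 (isT : prime 7) isT e7 e_nonconst.
(* The exponent [19 = 3 * 7 - 2] is 5 modulo 7, of multiplicative order 6, so six iterates would be
   distinct among five indices. *)
have : injective (fun k : 'I_6 => iter k s i).
  move=> k l /(congr1 e); rewrite !(weight_iter (q := 7) isT es e7).
  move=> /(weight_expr_eq (isT : prime 7) es e7 ei3).
  rewrite -[LHS]modnXm -[RHS]modnXm => kl; apply: val_inj.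
  by case: k kl => [[|[|[|[|[|[|//]]]]]] ?]; case: l => [[|[|[|[|[|[|//]]]]]] ?].
by move=> /leq_card; rewrite !card_ord.
Qed.

(** * The Klein cubic: smoothness and an automorphism of order 11 *)

Lemma sum_inord5 (W : nmodType) (g : 'I_5 -> W) :
  \sum_i g i = g (inord 0) + g (inord 1) + g (inord 2) + g (inord 3) + g (inord 4).
Proof.
rewrite !big_ord_recr big_ord0 /= add0r.
by do !congr (_ + _); congr g; apply: val_inj; rewrite /= inordK.
Qed.

Lemma forall_inord5 (Q : 'I_5 -> Prop) :
  Q (inord 0) -> Q (inord 1) -> Q (inord 2) -> Q (inord 3) -> Q (inord 4) ->
  forall i, Q i.
Proof.
move=> Q0 Q1 Q2 Q3 Q4 i; rewrite -(inord_val i).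
by case: i => [[|[|[|[|[|]]]]]].
Qed.

(* The powers of 9 = -2 modulo 11, ordered so that, with coordinates numbered
   from 0, the Klein cubic is the sum of the [x_i ^ 2 * x_j] such that
   [2 * klein_weight i + klein_weight j = 0] modulo 11. *)
Definition klein_weight (k : nat) : nat := nth 0%N [:: 1; 9; 3; 4; 5]%N k.

Section Klein.
Variable C : numClosedFieldType.
Notation V := 'rV[C]_5.

Lemma klein_cubicE (v : V) : (klein_cubic C).@[v 0] =
  v 0 (inord 0) ^+ 2 * v 0 (inord 1) + v 0 (inord 1) ^+ 2 * v 0 (inord 3)
  + v 0 (inord 3) ^+ 2 * v 0 (inord 2) + v 0 (inord 2) ^+ 2 * v 0 (inord 4)
  + v 0 (inord 4) ^+ 2 * v 0 (inord 0).
Proof.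
rewrite /klein_cubic /x_ /= !(mevalD, mevalM, rmorphXn) /= !mevalXU; ring.
Qed.

(** The hypotheses say that the gradient of [a ^ 2 b + b ^ 2 c + c ^ 2 d + d ^ 2 e + e ^ 2 a]
    vanishes. Each multiplied by a variable and by one of [1, -2, 4, -8, 16], they telescope to
    [(1 + 2 ^ 5) b ^ 2 c]; so [b c = 0], and the second one gives [a = 0]. *)
Lemma cyclic_gradient_eq0 (a b c d e : C) :
  2%:R * a * b + e ^+ 2 = 0 -> 2%:R * b * c + a ^+ 2 = 0 ->
  2%:R * c * d + b ^+ 2 = 0 -> 2%:R * d * e + c ^+ 2 = 0 ->
  2%:R * e * a + d ^+ 2 = 0 -> a = 0.
Proof.
move=> h1 h2 h3 h4 h5.
have : 33%:R * (b ^+ 2 * c) = 0.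
  transitivity (c * (2%:R * c * d + b ^+ 2) - 2%:R * (d * (2%:R * d * e + c ^+ 2))
    + 4%:R * (e * (2%:R * e * a + d ^+ 2)) - 8%:R * (a * (2%:R * a * b + e ^+ 2))
    + 16%:R * (b * (2%:R * b * c + a ^+ 2))); first by ring.
  by rewrite h1 h2 h3 h4 h5; ring.
move/eqP; rewrite !mulf_eq0 pnatr_eq0 orbb /= => bc0.
have {}bc0 : b * c = 0 by apply/eqP; rewrite mulf_eq0.
by move: h2; rewrite -mulrA bc0 mulr0 add0r => /eqP; rewrite expf_eq0 => /eqP.
Qed.

Lemma klein_cubic_smooth : smooth_cubic_threefold (klein_cubic C).
Proof.
split.
- apply/eqP => k0; have /eqP : 5%:R = 0 :> C; last by rewrite pnatr_eq0.
  transitivity ((klein_cubic C).@[(const_mx 1 : V) 0]); last by rewrite k0 meval0.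
  by rewrite klein_cubicE !mxE; ring.
- have X1 k : (x_ k : {mpoly C[5]}) \is 1.-homog by rewrite dhomogX /= mdeg1.
  have X2 k : (x_ k : {mpoly C[5]}) ^+ 2 \is 2.-homog by exact: (dhomogMn 2 (X1 k)).
  by rewrite /klein_cubic; do !apply: rpredD; exact: (dhomogM (X1 _) (X2 _)).
move=> v vN0 _; apply/existsP; apply: contraNT vN0 => /existsPn grad0.
have {}grad0 i : ((klein_cubic C)^`M(i)).@[v 0] = 0 by apply/eqP/negPn/grad0.
have XE (j k : nat) : (j < 5)%N -> (k < 5)%N ->
    (('X_(inord j) : {mpoly C[5]})^`M(inord k)).@[v 0] = (j == k)%:R.
  move=> j5 k5; rewrite mderivX mnm1E -val_eqE /= !inordK // mevalZ.
  case: eqP => [->|_]; last by rewrite mul0r.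
  by rewrite (_ : _ - _ = 0)%MM ?mpolyX0 ?meval1 ?mulr1 //; apply/mnmP => y;
    rewrite mnmBE mnm0E subnn.
pose y k := v 0 (inord k).
have mE (j k l : nat) : (j < 5)%N -> (k < 5)%N -> (l < 5)%N ->
    (('X_(inord j) * 'X_(inord k) ^+ 2 : {mpoly C[5]})^`M(inord l)).@[v 0] =
    (j == l)%:R * y k ^+ 2 + 2%:R * y j * y k * (k == l)%:R.
  move=> j5 k5 l5; rewrite expr2 !mderivM !(mevalD, mevalM) !XE // !mevalXU.
  by rewrite -!/(y _); ring.
have gE l : (l < 5)%N -> y 4%N ^+ 2 *+ (0%N == l) + 2%:R * y 0%N * y 4%N *+ (4%N == l)
    + y 2%N ^+ 2 *+ (4%N == l) + 2%:R * y 4%N * y 2%N *+ (2%N == l)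
    + y 3%N ^+ 2 *+ (2%N == l) + 2%:R * y 2%N * y 3%N *+ (3%N == l)
    + y 1%N ^+ 2 *+ (3%N == l) + 2%:R * y 3%N * y 1%N *+ (1%N == l)
    + y 0%N ^+ 2 *+ (1%N == l) + 2%:R * y 1%N * y 0%N *+ (0%N == l) = 0.
  move=> l5; rewrite -[RHS](grad0 (inord l)) /klein_cubic /x_ !mderivD !mevalD !mE //.
  by rewrite !mulr_natr !mulr_natl !addrA.
have h0 : 2%:R * y 0%N * y 1%N + y 4%N ^+ 2 = 0 by rewrite -[RHS](gE 0%N isT) /=; ring.
have h1 : 2%:R * y 1%N * y 3%N + y 0%N ^+ 2 = 0 by rewrite -[RHS](gE 1%N isT) /=; ring.
have h3 : 2%:R * y 3%N * y 2%N + y 1%N ^+ 2 = 0 by rewrite -[RHS](gE 3%N isT) /=; ring.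
have h2 : 2%:R * y 2%N * y 4%N + y 3%N ^+ 2 = 0 by rewrite -[RHS](gE 2%N isT) /=; ring.
have h4 : 2%:R * y 4%N * y 0%N + y 2%N ^+ 2 = 0 by rewrite -[RHS](gE 4%N isT) /=; ring.
(* The variables of the cubic follow each other in the cycle 0, 1, 3, 2, 4, so each coordinate takes
   the role of [a] in turn. *)
apply/eqP/rowP; apply: forall_inord5; rewrite [RHS]mxE.
- exact: cyclic_gradient_eq0 h0 h1 h3 h2 h4.
- exact: cyclic_gradient_eq0 h1 h3 h2 h4 h0.
- exact: cyclic_gradient_eq0 h2 h4 h0 h1 h3.
- exact: cyclic_gradient_eq0 h3 h2 h4 h0 h1.
- exact: cyclic_gradient_eq0 h4 h0 h1 h3 h2.
Qed.

Lemma klein_cubic_order11 :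
  has_automorphism_of_order (zero_locus (klein_cubic C)) 11.
Proof.
have [z z_prim] := primitive_root_exists C (isT : 0 < 11)%N.
have z11 k : z ^+ (11 * k) = 1 by rewrite exprM (prim_expr_order z_prim) expr1n.
have zN0 : z != 0.
  by apply/eqP => z0; have /eqP := z11 1%N; rewrite z0 expr0n eq_sym oner_eq0.
(* With these exponents every monomial of the Klein cubic is multiplied by [z ^ 11] or [z ^ 22],
   hence invariant. *)
pose M : 'M[C]_5 := diag_mx (\row_i z ^+ klein_weight i).
have vMX (v : V) m i : (v *m M ^+ m) 0 i = v 0 i * z ^+ (klein_weight i * m).
  elim: m => [|m IH]; first by rewrite expr0 mulmx1 muln0 mulr1.
  by rewrite exprSr mulmxA mul_mx_diag [LHS]mxE IH [X in _ * X]mxE mulnS addnC exprD mulrA.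
have Mu : M \in unitmx.
  rewrite unitmxE det_diag unitfE; apply/prodf_neq0 => i _.
  by rewrite mxE expf_neq0.
have kM (v : V) : (klein_cubic C).@[(v *m M) 0] = (klein_cubic C).@[v 0].
  rewrite !klein_cubicE -[M]expr1 !vMX !muln1 /klein_weight !inordK //=.
  pose y k := v 0 (inord k); rewrite -!/(y _).
  transitivity (y 0%N ^+ 2 * y 1%N * z ^+ (11 * 1)
    + y 1%N ^+ 2 * y 3%N * z ^+ (11 * 2) + y 3%N ^+ 2 * y 2%N * z ^+ (11 * 1)
    + y 2%N ^+ 2 * y 4%N * z ^+ (11 * 1) + y 4%N ^+ 2 * y 0%N * z ^+ (11 * 1)).
    by ring.
  by rewrite !z11 !mulr1.
have fM x : zero_locus (klein_cubic C) x ->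
  val (projectivity Mu x) = (linfun (mulmxr M) @: val x)%VS by [].
have f_iso := zero_locus_isomorphism Mu kM : isomorphism _ _ (projectivity Mu).
exists (projectivity Mu); split; first by split=> //; exists M.
have iterE m x v : zero_locus (klein_cubic C) x -> val x = <[v]>%VS ->
    val (iter m (projectivity Mu) x) = <[v *m M ^+ m]>%VS.
  move=> xX xE; have [fX _] := f_iso.1.
  by have [] := iter_projective fX fM m xX xE.
split=> // [x xX|m /andP[m_gt0 m_lt] f_id].
  apply: P4_eqP; have [v vN0 xE] := P4_vlineP x; rewrite (iterE _ _ _ xX xE) xE.
  congr <[_]>%VS; apply/rowP => i.
  by rewrite vMX mulnC z11 mulr1.
(* Only the coordinates 0 and 3 are non-zero here, so all five monomials vanish. If the [m]-th
   iterate fixed this point, [z ^ m = z ^ (4 m)] would give [11 | 3 m]. *)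
pose v : V := delta_mx 0 (inord 0) + delta_mx 0 (inord 3).
have vE (k : nat) : (k < 5)%N -> v 0 (inord k) = ((k == 0) || (k == 3))%N%:R.
  move=> k5; rewrite !mxE -!val_eqE /= !inordK // eq_sym.
  by case: k k5 => [|[|[|[|[|]]]]] //= _; rewrite ?addr0 ?add0r.
have vN0 : v != 0.
  by apply/eqP => /rowP/(_ (inord 0)); rewrite vE // mxE => /eqP; rewrite oner_eq0.
have vX : zero_locus (klein_cubic C) (point vN0).
  by move=> _ /vlineP[a ->]; rewrite klein_cubicE ![(a *: v) 0 _]mxE !vE //=; ring.
have := iterE m _ v vX erefl; rewrite f_id // => vmE.
have /vlineP[a vmE'] : v *m M ^+ m \in <[v]>%VS.
  by rewrite (vmE : <[v]>%VS = _) memv_line.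
have := vMX v m (inord 3); have := vMX v m (inord 0).
rewrite vmE' [(a *: v) 0 _]mxE [(a *: v) 0 (inord 3)]mxE !vE //=.
rewrite !mulr1 !mul1r /klein_weight !inordK //= mul1n => -> /eqP.
rewrite (eq_prim_root_expr z_prim) eq_sym eqn_mod_dvd ?leq_pmull //.
rewrite -{2}[m]mul1n -mulnBl /= Gauss_dvdr // => // /(dvdn_leq m_gt0).
by rewrite leqNgt m_lt.
Qed.

End Klein.

(** * Normal form of a cubic with an automorphism of order 11 *)

Section Order11.
Variable C : numClosedFieldType.
Notation V := 'rV[C]_5.

(** The exponent [31 = 3 * 11 - 2] is 9 modulo 11, of multiplicative order 5. From a weight that is
    not a cube root of unity, the iterates of [s] thus run through the whole basis, which is then
    reordered to match [klein_weight]. *)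
Lemma order11_klein_basis (F : {mpoly C[5]}) (T : symtrilinear V) :
  smooth_trilinear T -> (forall v : V, F.@[v 0] = T v v v) ->
  has_automorphism_of_order (zero_locus F) 11 ->
  exists2 Q : 'M[C]_5, Q \in unitmx &
    forall i j k, T (row i Q) (row j Q) (row k Q) != 0 ->
      (11 %| klein_weight i + klein_weight j + klein_weight k)%N.
Proof.
move=> T_smooth FE.
move=> /(weights (isT : 1 < 11)%N T_smooth FE)[P [e [nu [Pu eT e11 e_nonconst]]]].
have /fin_all_exists[s sT] i : exists j, T (row i P) (row i P) (row j P) != 0.
  exact: smooth_row_neighbour.
have es i : e i ^+ 2 * e (s i) = 1 by rewrite expr2; exact: eT.
have [i ei3] := weight_cube_neq1 (isT : prime 11) isT e11 e_nonconst.
have expr_eq := weight_expr_eq (isT : prime 11) es e11 ei3.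
(* [pos j] is the exponent for which [9 ^ pos j = klein_weight j] modulo 11. *)
pose pos := nth 0%N [:: 0; 1; 3; 2; 4]%N.
pose h (j : 'I_5) := iter (pos j) s i.
have eh j : e (h j) = e i ^+ (31 ^ pos j) by rewrite (weight_iter (q := 11) isT es e11).
have weightE (j : 'I_5) : (31 ^ pos j = klein_weight j %[mod 11])%N.
  by rewrite -[LHS]modnXm; case: j => [[|[|[|[|[|]]]]]].
have h_inj : injective h.
  move=> j k /(congr1 e); rewrite !eh => /expr_eq; rewrite !weightE => jk.
  apply: val_inj; move: jk.
  by case: j => [[|[|[|[|[|//]]]]] ?]; case: k => [[|[|[|[|[|//]]]]] ?].
exists (row_perm (perm h_inj) P) => [|j k l].
  by rewrite row_permE unitmx_mul unitmx_perm.
have rowE m : row m (row_perm (perm h_inj) P) = row (h m) P.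
  by apply/rowP => n; rewrite !mxE permE.
rewrite !rowE => /eT; rewrite !eh -!exprD -[RHS](expr0 (e i)) => /expr_eq.
rewrite mod0n -modnDm -(modnDm (31 ^ pos j)) !weightE modnDm -modnDml modnDm modnDml => w0.
by rewrite /dvdn w0.
Qed.

(** The first four equations give [l1], ..., [l4] successively in terms of [l0]; the last one then
    becomes [l0 ^ 33 = K]. *)
Lemma klein_scaling (c0 c1 c2 c3 c4 : C) :
  c0 != 0 -> c1 != 0 -> c2 != 0 -> c3 != 0 -> c4 != 0 ->
  exists l0 l1 l2 l3 l4,
    [/\ l0 != 0, l1 != 0, l2 != 0, l3 != 0 & l4 != 0] /\
    [/\ c0 * l0 ^+ 2 * l1 = 1, c1 * l1 ^+ 2 * l2 = 1, c2 * l2 ^+ 2 * l3 = 1,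
        c3 * l3 ^+ 2 * l4 = 1 & c4 * l4 ^+ 2 * l0 = 1].
Proof.
move=> c0N0 c1N0 c2N0 c3N0 c4N0.
pose K := c3 ^+ 2 * c1 ^+ 8 / (c4 * c2 ^+ 4 * c0 ^+ 16).
have KN0 : K != 0 by rewrite !(mulf_neq0, invr_neq0, expf_neq0).
pose l := 33.-root K; have lK : l ^+ 33 = K by rewrite rootCK.
have lN0 : l != 0 by apply: contraNneq KN0 => l0; rewrite -lK l0 expr0n.
pose l1 := (c0 * l ^+ 2)^-1; have l1N0 : l1 != 0.
  by rewrite !(mulf_neq0, invr_neq0, expf_neq0).
pose l2 := (c1 * l1 ^+ 2)^-1; have l2N0 : l2 != 0.
  by rewrite !(mulf_neq0, invr_neq0, expf_neq0).
pose l3 := (c2 * l2 ^+ 2)^-1; have l3N0 : l3 != 0.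
  by rewrite !(mulf_neq0, invr_neq0, expf_neq0).
pose l4 := (c3 * l3 ^+ 2)^-1; have l4N0 : l4 != 0.
  by rewrite !(mulf_neq0, invr_neq0, expf_neq0).
exists l, l1, l2, l3, l4; split=> //; split.
1-4: by rewrite mulfV // !(mulf_neq0, expf_neq0).
transitivity (l ^+ 33 / K); last by rewrite lK divff.
have l2E : l2 = c0 ^+ 2 * l ^+ 4 / c1 by rewrite /l2 /l1; field; rewrite c0N0 c1N0 lN0.
have l4E : l4 = c0 ^+ 8 * c2 ^+ 2 * l ^+ 16 / (c1 ^+ 4 * c3).
  by rewrite /l4 /l3 l2E; field; rewrite c0N0 c1N0 c2N0 c3N0 lN0.
by rewrite l4E /K; field; rewrite c0N0 c1N0 c2N0 c3N0 c4N0.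
Qed.

Lemma order11_normal_form (F : {mpoly C[5]}) : smooth_cubic_threefold F ->
  has_automorphism_of_order (zero_locus F) 11 ->
  exists2 M : 'M[C]_5, M \in unitmx &
    forall v : V, (klein_cubic C).@[(v *m M) 0] = F.@[v 0].
Proof.
move=> /smooth_polarization[T T_smooth FE] /(order11_klein_basis T_smooth FE).
move=> [Q Qu QT].
have next i : exists j, T (row i Q) (row i Q) (row j Q) != 0.
  exact: smooth_row_neighbour.
pose f k : V := row (inord k) Q.
(* When the weights allow only [j = l], the neighbour of [k] provided by smoothness must be [l]. The
   boolean condition is settled by computation. *)
have nextE k l : (k < 5)%N -> (l < 5)%N ->
    all (fun j => (11 %| klein_weight k + klein_weight k + klein_weight j)%N
      ==> (j == l)) (iota 0 5)%N ->
    T (f k) (f k) (f l) != 0.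
  move=> k5 l5 /allP kl; have [j jN0] := next (inord k).
  have := QT _ _ _ jN0; have := kl j; rewrite mem_iota /= ltn_ord => /(_ isT).
  rewrite inordK // => /implyP kjl /kjl/eqP jl.
  by rewrite /f -jl inord_val.
(* The values of [T] get an opaque name [t], so that rewriting with [tE] discards the terms of
   non-zero weight without applying again to its own result. *)
have [t [tT tE]] : exists t : nat -> nat -> nat -> C,
    (forall i j k, t i j k = T (f i) (f j) (f k)) /\
    forall i j k, (i < 5)%N -> (j < 5)%N -> (k < 5)%N -> T (f i) (f j) (f k) =
    if (11 %| klein_weight i + klein_weight j + klein_weight k)%N then t i j k else 0.
  exists (fun i j k => T (f i) (f j) (f k)); split=> // i j k i5 j5 k5.
  case: ifP => // wN0; apply/eqP; apply: contraFT wN0 => /QT.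
  by rewrite !inordK.
have t12 i j k : t i j k = t j i k by rewrite !tT trilinearC12.
have t23 i j k : t i j k = t i k j by rewrite !tT trilinearC23.
(* The factor 3 makes this the coefficient of [x_k ^ 2 x_l] in the cubic. *)
have tN0 k l : (k < 5)%N -> (l < 5)%N ->
    all (fun j => (11 %| klein_weight k + klein_weight k + klein_weight j)%N
      ==> (j == l)) (iota 0 5)%N ->
    3%:R * t k k l != 0.
  by move=> k5 l5 kl; rewrite mulf_neq0 ?pnatr_eq0 // tT nextE.
have [l0 [l1 [l2 [l3 [l4 [[l0N0 l1N0 l2N0 l3N0 l4N0] [E0 E1 E2 E3 E4]]]]]]] :=
  klein_scaling (tN0 0%N 1%N isT isT isT) (tN0 1%N 3%N isT isT isT)
    (tN0 3%N 2%N isT isT isT) (tN0 2%N 4%N isT isT isT)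
    (tN0 4%N 0%N isT isT isT).
(* The scaling factors are numbered along the cycle 0, 1, 3, 2, 4, whence the exchange of [l2] and
   [l3]. *)
pose L (k : 'I_5) := nth (0 : C) [:: l0; l1; l3; l2; l4] k.
pose N : 'M[C]_5 := diag_mx (\row_k L k) *m Q.
have Nu : N \in unitmx.
  rewrite unitmx_mul Qu andbT unitmxE det_diag unitfE; apply/prodf_neq0 => i _.
  by rewrite mxE; case: i => [[|[|[|[|[|]]]]]].
have NE (v : V) : F.@[(v *m N) 0] = (klein_cubic C).@[v 0].
  have -> : v *m N = (v 0 (inord 0) * l0) *: f 0%N + (v 0 (inord 1) * l1) *: f 1%N
     + (v 0 (inord 2) * l3) *: f 2 + (v 0 (inord 3) * l2) *: f 3%N
     + (v 0 (inord 4) * l4) *: f 4%N.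
    rewrite mulmxA mulmx_sum_row sum_inord5 /f.
    by rewrite !mul_mx_diag !mxE /L !inordK //.
  rewrite FE klein_cubicE.
  pose y k := v 0 (inord k); rewrite -!/(y _); set w := (X in T X X X).
  have wE : w = (y 0%N * l0) *: f 0%N + (y 1%N * l1) *: f 1%N
    + (y 2%N * l3) *: f 2%N + (y 3%N * l2) *: f 3%N + (y 4%N * l4) *: f 4%N by [].
  pose tw i j k := if (11 %| klein_weight i + klein_weight j + klein_weight k)%N
    then t i j k else 0.
  have Tw i j : (i < 5)%N -> (j < 5)%N -> T (f i) (f j) w =
      y 0%N * l0 * tw i j 0%N + y 1%N * l1 * tw i j 1%N + y 2%N * l3 * tw i j 2%N
      + y 3%N * l2 * tw i j 3%N + y 4%N * l4 * tw i j 4%N.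
    by move=> i5 j5; rewrite wE !(trilinearD3, trilinearZ3) !tE.
  rewrite {1}wE !(trilinearD1, trilinearZ1) {1 3 5 7 9}wE !(trilinearD2, trilinearZ2).
  rewrite !Tw // {Tw}/tw /=.
  rewrite (t12 1%N 0%N 0%N) (t23 0%N 1%N 0%N) (t12 3%N 1%N 1%N) (t23 1%N 3%N 1%N).
  rewrite (t12 2%N 3%N 3%N) (t23 3%N 2%N 3%N) (t12 4%N 2%N 2%N)
    (t23 2%N 4%N 2%N) (t12 0%N 4%N 4%N) (t23 4%N 0%N 4%N).
  transitivity (y 0%N ^+ 2 * y 1%N * (3%:R * t 0%N 0%N 1%N * l0 ^+ 2 * l1)
    + y 1%N ^+ 2 * y 3%N * (3%:R * t 1%N 1%N 3%N * l1 ^+ 2 * l2)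
    + y 3%N ^+ 2 * y 2%N * (3%:R * t 3%N 3%N 2%N * l2 ^+ 2 * l3)
    + y 2%N ^+ 2 * y 4%N * (3%:R * t 2%N 2%N 4%N * l3 ^+ 2 * l4)
    + y 4%N ^+ 2 * y 0%N * (3%:R * t 4%N 4%N 0%N * l4 ^+ 2 * l0)).
    by ring.
  by rewrite E0 E1 E2 E3 E4 !mulr1.
exists (invmx N); first by rewrite unitmx_inv.
by move=> v; rewrite -NE mulmxKV.
Qed.

End Order11.

Theorem proposition1 (R : realType) :
  (forall F : {mpoly (complex R)[5]}, smooth_cubic_threefold F ->
     ~ has_automorphism_of_order (zero_locus F) 7) /\
  [/\ smooth_cubic_threefold (klein_cubic (complex R)),
      has_automorphism_of_order (zero_locus (klein_cubic (complex R))) 11 &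
      forall F : {mpoly (complex R)[5]}, smooth_cubic_threefold F ->
        has_automorphism_of_order (zero_locus F) 11 ->
        isomorphic (zero_locus F) (zero_locus (klein_cubic (complex R)))].
Proof.
split=> [F|]; first exact: no_order7.
split; [exact: klein_cubic_smooth | exact: klein_cubic_order11 |].
move=> F F_smooth /(order11_normal_form F_smooth)[M Mu FM].
by exists (projectivity Mu); exact: zero_locus_isomorphism.
Qed.
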